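(* Let $k$ be a field of characteristic $p$, $p$ an odd prime, $d$ a positive integer not divisible by $p$, and $1<J<p$. With $S$, $b_{\lambda,n}$, $C_J$, $R_J$, $M$, $N$, $R_N$, $C_N$, $T_N$, $\phi$, $Pr(\sigma)$, $\Gamma(\sigma)$ and $LM$ as in the context: (1) if $((i,\lambda),i')\in T_N$ then $LM(N_{i,i'})=LM(b_{\lambda,pi-i'})=a_{\phi(i,i')}a_d^{\lambda-1}$; (2) for a bijection $\sigma:R_N\to C_N$, $Pr(\sigma)\ne0$ if and only if $\Gamma(\sigma)\subseteq T_N$; (3) if $\Gamma(\sigma)\subseteq T_N$, then $LM(Pr(\sigma))=a_0^{e_0}a_1^{e_1}\cdots a_{d-1}^{e_{d-1}}a_d^{e_d+\Lambda}$, where for $0\le\ell\le d$, $e_\ell=|\{i\in R_N:\phi(i,\sigma(i))=\ell\}|$, and $\Lambda=\sum_{(i,\lambda)\in R_N}(\lambda-1)$; (4) there exists a bijection $\sigma_0:R_N\to C_N$ with $\Gamma(\sigma_0)\subseteq T_N$ such that for every other bijection $\sigma\ne\sigma_0$ with $\Gamma(\sigma)\subseteq T_N$, $LM(Pr(\sigma_0))>LM(Pr(\sigma))$; (5) $\det(N)\in S$ is non-zero.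
   Context: $S=k[a_0,\dots,a_d]$ is a polynomial ring, $f=a_0+a_1x+\cdots+a_dx^d\in S[x]$, and $b_{\lambda,n}\in S$ is the coefficient of $x^n$ in $f^\lambda$ (zero for $n>\lambda d$). $C_J=\{i'\in\mathbb{Z}: 0<i'<(p-J)d/p,\ p\nmid i'\}$, ordered by size; $R_J=\{(i,\lambda)\in\mathbb{Z}^2: 0<\lambda<J,\ (p\lambda-J+1)d/p^2<i<(p(\lambda+1)-J)d/p^2\}$, ordered by size of $i$ (each $i$ determines $\lambda$ uniquely, so elements of $R_J$ are written $i$). $M$ is the matrix with rows indexed by $R_J$, columns by $C_J$, entries $M_{i,i'}=b_{\lambda,pi-i'}$. If $J\le(p+1)/2$, $N$ is the submatrix of $M$ formed by the last (largest) $|R_J|$ columns; if $J\ge(p+1)/2$, $N$ is the submatrix formed by the first (smallest) $|C_J|$ rows; $N$ is square. $R_N$ and $C_N$ are the row and column index sets of $N$. $T_N$ is the set of $(i,i')\in R_N\times C_N$ with $pi-i'\le\lambda d$ (equivalently $N_{i,i'}\ne0$), and $\phi(i,i')=pi-i'-(\lambda-1)d\in\{1,\dots,d\}$ on $T_N$. For a bijection $\sigma:R_N\to C_N$, $Pr(\sigma)=\prod_{i\in R_N}N_{i,\sigma(i)}$ and $\Gamma(\sigma)=\{(i,\sigma(i)):i\in R_N\}$. Monomials of $S$ are ordered by: $a_0^{e_0}\cdots a_d^{e_d}<a_0^{f_0}\cdots a_d^{f_d}$ if, for the largest index $i$ with $e_i\ne f_i$, $e_i<f_i$; $LM(g)$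 is the leading monomial of a nonzero $g\in S$ for this order. *)

(* Defs.v *)
From HB Require Import structures.
From mathcomp Require Import all_boot all_order all_algebra.
From mathcomp Require Import mpoly.
From mathcomp Require Import zify lra.

Set Implicit Arguments.
Unset Strict Implicit.
Unset Printing Implicit Defensive.

Import Order.TTheory GRing.Theory Num.Theory.
Local Open Scope ring_scope.

(* The order compares exponents of the largest-index variable first; it is not
   the degrevlex order underlying [mlead]. *)
Definition mlex_lt (n : nat) (m1 m2 : 'X_{1..n}) : bool :=
  [exists i : 'I_n,
    (m1 i < m2 i)%N && [forall j : 'I_n, (i < j)%N ==> (m1 j == m2 j)]].

(* Junk value 0%MM at g = 0. *)
Definition LM (k : fieldType) (n : nat) (g : {mpoly k[n]}) : 'X_{1..n} :=
  foldr (fun m acc => if mlex_lt acc m then m else acc) 0%MM (msupp g).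

Definition genpoly (k : fieldType) (d : nat) : {poly {mpoly k[d.+1]}} :=
  \sum_(i < d.+1) ('X_i)%:P * 'X^i.

Definition bcoef (k : fieldType) (d l n : nat) : {mpoly k[d.+1]} :=
  (genpoly k d ^+ l)`_n.

Definition inC (p d J : nat) (i' : int) : bool :=
  [&& 0 < i', (i'%:~R < (p%:R - J%:R) * d%:R / p%:R :> rat)
    & ~~ (p %| i')%Z].

Definition inR (p d J : nat) (i l : int) : bool :=
  [&& 0 < l < J%:Z,
      ((p%:R * l%:~R - J%:R + 1) * d%:R / p%:R ^+ 2 < i%:~R :> rat)
    & (i%:~R < (p%:R * (l%:~R + 1) - J%:R) * d%:R / p%:R ^+ 2 :> rat)].

(* The bounds i' < d, i < d and l < J of the enumerations lose nothing: see
   [mem_CJ] and [mem_RJ]. *)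
Definition CJ (p d J : nat) : seq nat :=
  [seq i' <- iota 0 d | inC p d J i'%:Z].

Definition RJ (p d J : nat) : seq (nat * nat) :=
  sort (fun x y : nat * nat => (x.1 <= y.1)%N)
    [seq x <- [seq (i, l) | i <- iota 0 d, l <- iota 0 J]
       | inR p d J x.1%:Z x.2%:Z].

Definition bmx (k : fieldType) (p d : nat) (R : seq (nat * nat))
    (C : seq nat) : 'M[{mpoly k[d.+1]}]_(size R, size C) :=
  \matrix_(r, c)
    bcoef k d (tnth (in_tuple R) r).2
      (p * (tnth (in_tuple R) r).1 - tnth (in_tuple C) c).

Definition Mmx (k : fieldType) (p d J : nat) :
    'M[{mpoly k[d.+1]}]_(size (RJ p d J), size (CJ p d J)) :=
  bmx k p d (RJ p d J) (CJ p d J).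

(* The submatrix N of M is given by the sublists RN of RJ and CN of CJ that
   index it, since an entry depends only on the indices (i, l) and i'.
   The two cases of the definition of N overlap at 2 * J = p + 1, where RJ and
   CJ have the same size, so that both give RN = RJ and CN = CJ. *)
Definition RN (p d J : nat) : seq (nat * nat) :=
  if (2 * J <= p + 1)%N then RJ p d J
  else take (size (CJ p d J)) (RJ p d J).

Definition CN (p d J : nat) : seq nat :=
  if (2 * J <= p + 1)%N
  then drop (size (CJ p d J) - size (RJ p d J)) (CJ p d J)
  else CJ p d J.

Definition rowN (p d J : nat) (r : 'I_(size (RN p d J))) : nat * nat :=
  tnth (in_tuple (RN p d J)) r.

Definition colN (p d J : nat) (c : 'I_(size (CN p d J))) : nat :=
  tnth (in_tuple (CN p d J)) c.

(* Natural subtraction: never truncated on RJ x CJ, see [RJ_CJ_lt]. *)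
Definition degN (p d J : nat) (r : 'I_(size (RN p d J)))
    (c : 'I_(size (CN p d J))) : nat :=
  (p * (rowN r).1 - colN c)%N.

Definition Nmx (k : fieldType) (p d J : nat) :
    'M[{mpoly k[d.+1]}]_(size (RN p d J), size (CN p d J)) :=
  bmx k p d (RN p d J) (CN p d J).

Definition inTN (p d J : nat) (r : 'I_(size (RN p d J)))
    (c : 'I_(size (CN p d J))) : bool :=
  (degN r c <= (rowN r).2 * d)%N.

Definition phi (p d J : nat) (r : 'I_(size (RN p d J)))
    (c : 'I_(size (CN p d J))) : nat :=
  (degN r c - ((rowN r).2 - 1) * d)%N.

Definition graph_in_TN (p d J : nat)
    (s : {ffun 'I_(size (RN p d J)) -> 'I_(size (CN p d J))}) : Prop :=
  forall r, inTN r (s r).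

Definition Pr (k : fieldType) (p d J : nat)
    (s : {ffun 'I_(size (RN p d J)) -> 'I_(size (CN p d J))}) :
    {mpoly k[d.+1]} :=
  \prod_r Nmx k p d J r (s r).

Definition Lambda (p d J : nat) : nat :=
  (\sum_(r < size (RN p d J)) ((rowN r).2 - 1))%N.

Lemma inCE (p d J : nat) (i' : nat) : (0 < p)%N -> (J <= p)%N ->
  inC p d J i'%:Z = [&& (0 < i')%N, (p * i' < (p - J) * d)%N & ~~ (p %| i')%N].
Proof.
move=> p0 Jp; rewrite /inC; congr [&& _, _ & _].
rewrite ltr_pdivlMr ?ltr0n // -natrB // -pmulrn -!natrM ltr_nat.
by rewrite mulnC.
Qed.

Lemma inRE (p d J i l : nat) : (0 < p)%N -> (J < p)%N ->
  inR p d J i%:Z l%:Z =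
  [&& (0 < l < J)%N, ((p * l - J + 1) * d < p ^ 2 * i)%N
    & (p ^ 2 * i < (p * (l + 1) - J) * d)%N].
Proof.
move=> p0 Jp; rewrite /inR; have -> : (0 < l%:Z < J%:Z) = (0 < l < J)%N by [].
case: (boolP (0 < l < J)%N) => //= /andP[l0 lJ].
have p20 : (0 : rat) < p%:R ^+ 2 by rewrite exprn_gt0 // ltr0n.
have J1 : (J <= p * l)%N by nia.
have J2 : (J <= p * (l + 1))%N by nia.
rewrite ltr_pdivrMr // ltr_pdivlMr // -!pmulrn.
rewrite -[1]/(1%:R) -natrX -natrD -!natrM -!natrB // -natrD -!natrM !ltr_nat.
by rewrite [(i * _)%N]mulnC.
Qed.

Lemma mem_CJ (p d J : nat) (z : int) : (0 < p)%N -> (J < p)%N ->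
  inC p d J z <-> exists2 i' : nat, i' \in CJ p d J & z = i'%:Z.
Proof.
move=> p0 Jp; split; last first.
  by case=> i'; rewrite mem_filter => /andP[Ci' _] ->.
case: z => [i'|i'] Ci'; last by case/and3P: Ci'.
exists i' => //; rewrite mem_filter Ci' mem_iota add0n /=.
by move: Ci'; rewrite inCE ?(ltnW Jp) // => /and3P[_ h _]; nia.
Qed.

Lemma mem_RJ (p d J : nat) (z y : int) : (0 < p)%N -> (J < p)%N ->
  inR p d J z y <->
  exists2 x : nat * nat, x \in RJ p d J & z = x.1%:Z /\ y = x.2%:Z.
Proof.
move=> p0 Jp; split; last first.
  by case=> x; rewrite mem_sort mem_filter => /andP[Rx _] [-> ->].
case: y => [l|l] Rzl; last by case/and3P: Rzl.
case: z Rzl => [i|i] Rzl; last first.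
  case/and3P: Rzl => /andP[l0 _] h _; exfalso; move: h; apply/negP.
  rewrite -leNgt; apply: (@le_trans _ _ 0); first by rewrite lerz0.
  rewrite divr_ge0 ?exprn_ge0 ?ler0n // mulr_ge0 ?ler0n // -pmulrn.
  have: (J%:R <= p%:R * l%:R :> rat) by rewrite -natrM ler_nat; nia.
  lra.
exists (i, l) => //; rewrite mem_sort mem_filter Rzl.
apply/allpairsP; exists (i, l); rewrite !mem_iota !add0n /=.
move: Rzl; rewrite inRE // => /and3P[/andP[l0 lJ] _ h].
split=> //.
have h2 : (p * (l + 1) - J <= p ^ 2)%N by nia.
have : (p ^ 2 * i < p ^ 2 * d)%N.
  by apply: leq_trans h _; rewrite leq_mul2r h2 orbT.
by rewrite ltn_pmul2l // expn_gt0 p0.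
Qed.

Lemma RJ_lambda_uniq (p d J i l1 l2 : nat) : (0 < p)%N -> (J < p)%N ->
  (i, l1) \in RJ p d J -> (i, l2) \in RJ p d J -> l1 = l2.
Proof.
move=> p0 Jp; rewrite !mem_sort !mem_filter /= !inRE //.
have aux a b : (0 < a)%N -> (a < b)%N ->
    (p ^ 2 * i < (p * (a + 1) - J) * d)%N ->
    ((p * b - J + 1) * d < p ^ 2 * i)%N -> False.
  move=> a0 ab h1 h2; have := ltn_trans h2 h1; apply/negP; rewrite -leqNgt.
  by rewrite leq_mul2r; apply/orP; right; nia.
move=> /andP[/and3P[/andP[a0 _] h1 h2] _] /andP[/and3P[/andP[b0 _] h3 h4] _].
case: (ltngtP l1 l2) => // ll.
  by case: (aux _ _ a0 ll h2 h3).
by case: (aux _ _ b0 ll h4 h1).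
Qed.

Lemma CJ_sorted (p d J : nat) : sorted ltn (CJ p d J).
Proof. by apply: sorted_filter; [exact: ltn_trans | exact: iota_ltn_sorted]. Qed.

Lemma RJ_sorted (p d J : nat) : (0 < p)%N -> (J < p)%N ->
  sorted ltn [seq x.1 | x <- RJ p d J].
Proof.
move=> p0 Jp; rewrite ltn_sorted_uniq_leq; apply/andP; split.
  rewrite map_inj_in_uniq.
    rewrite sort_uniq filter_uniq // allpairs_uniq ?iota_uniq //.
    by case=> a b [a' b'].
  case=> i l1 [i2 l2] /= h1 h2 e; move: h2; rewrite -e => h2.
  by rewrite (RJ_lambda_uniq p0 Jp h1 h2).
by rewrite sorted_map; apply: sort_sorted => x y; exact: leq_total.
Qed.

Lemma RJ_CJ_lt (p d J i l i' : nat) : (0 < p)%N -> (J < p)%N ->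
  (i, l) \in RJ p d J -> i' \in CJ p d J -> ((l - 1) * d + i' < p * i)%N.
Proof.
move=> p0 Jp; rewrite mem_sort !mem_filter /= inRE // inCE ?(ltnW Jp) //.
move=> /andP[/and3P[/andP[l0 lJ] h1 _] _] /andP[/and3P[_ h2 _] _].
rewrite -(ltn_pmul2l p0) mulnDr.
have e : ((p * (l - 1)) * d + (p - J) * d <= (p * l - J + 1) * d)%N.
  by rewrite -mulnDl leq_mul2r; apply/orP; right; nia.
have -> : (p * (p * i) = p ^ 2 * i)%N by rewrite mulnA.
rewrite mulnA; lia.
Qed.

Lemma mlex_lt_total (n : nat) (m1 m2 : 'X_{1..n}) :
  m1 != m2 -> mlex_lt m1 m2 || mlex_lt m2 m1.
Proof.
move=> ne; have [i0 hi0] : exists i, m1 i != m2 i.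
  apply/existsP; apply: contraNT ne; rewrite negb_exists => /forallP h.
  by apply/eqP/mnmP => i; apply/eqP; rewrite -[_ == _]negbK h.
case: (@arg_maxnP _ i0 (fun i => m1 i != m2 i) (fun i => val i) hi0).
move=> i hi hmax; have heq (j : 'I_n) : (i < j)%N -> m1 j == m2 j.
  by move=> ij; apply/negPn/negP => /hmax /=; rewrite leqNgt ij.
move: hi; rewrite neq_ltn => /orP[hi|hi]; apply/orP; [left|right];
  apply/existsP; exists i; rewrite hi; apply/forallP => j; apply/implyP.
  exact: heq.
by rewrite eq_sym; exact: heq.
Qed.

Lemma mlex_lt_irr (n : nat) (m : 'X_{1..n}) : mlex_lt m m = false.
Proof. by apply/existsP => -[i]; rewrite ltnn. Qed.

Lemma mlex_lt_trans (n : nat) (m2 m1 m3 : 'X_{1..n}) :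
  mlex_lt m1 m2 -> mlex_lt m2 m3 -> mlex_lt m1 m3.
Proof.
move=> /existsP[i /andP[hi /forallP Hi]] /existsP[j /andP[hj /forallP Hj]].
apply/existsP; case: (ltngtP i j) => ij.
- exists j; rewrite (eqP (implyP (Hi j) ij)) hj; apply/forallP => u.
  apply/implyP => ju; rewrite (eqP (implyP (Hi u) (ltn_trans ij ju))).
  exact: (implyP (Hj u)).
- exists i; rewrite -(eqP (implyP (Hj i) ij)) hi; apply/forallP => u.
  apply/implyP => iu; rewrite (eqP (implyP (Hi u) iu)).
  exact: (implyP (Hj u) (ltn_trans ij iu)).
- have e := val_inj ij; rewrite -{}e in hj Hj.
  exists i; rewrite (ltn_trans hi hj); apply/forallP => u.
  apply/implyP => iu; rewrite (eqP (implyP (Hi u) iu)).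
  exact: (implyP (Hj u) iu).
Qed.

Lemma LMP (k : fieldType) (n : nat) (g : {mpoly k[n]}) : g != 0 ->
  LM g \in msupp g /\
  (forall m, m \in msupp g -> m != LM g -> mlex_lt m (LM g)).
Proof.
have lt0 m : m != 0%MM -> mlex_lt (0%MM : 'X_{1..n}) m.
  move=> m0; have /orP[|//] := mlex_lt_total m0.
  by case/existsP=> i /andP[]; rewrite mnm0E ltn0.
rewrite -msupp_eq0 /LM; elim: (msupp g) => // a s IH _ /=.
case: (eqVneq s [::]) => [-> /=|/IH [Hin Hmax]].
  case: ifP => [_|h]; rewrite inE; first by rewrite eqxx; split=> // m;
    rewrite inE => /eqP -> /eqP.
  have /eqP -> : a == 0%MM by apply: contraFT h => /lt0.
  by rewrite eqxx; split=> // m; rewrite inE => /eqP -> /eqP.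
case: ifP => h; rewrite inE; split.
- by rewrite eqxx.
- move=> m; rewrite inE => /orP[/eqP -> /eqP //|ms _].
  case: (eqVneq m (foldr (fun m acc => if mlex_lt acc m then m else acc) 0%MM s)).
    by move=> ->.
  by move=> /(Hmax _ ms) hm; exact: mlex_lt_trans hm h.
- by rewrite Hin orbT.
- move=> m; rewrite inE => /orP[/eqP -> na|ms]; last exact: Hmax.
  by have /orP[//|] := mlex_lt_total na; rewrite h.
Qed.

(* Main.v *)
(** For a row (i, l) put h = p i - (l - 1) d, so that phi(i, i') = h - i' and T_N
    is the condition phi <= d.  The h's are pairwise distinct because p does not
    divide (l - l') d, so each row and each column lies in at most one pair with a
    given value of phi.  The order on monomials asks to maximise the number of
    pairs with phi = d, then with phi = d - 1, and so on; an exchange argument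
    shows that a single bijection is maximal.  A bijection inside T_N exists
    because a row with p i - l d > 0 meets phi = d at the column p i - l d of M; if
    that column is not kept in N, or if p i - l d < 0, then every column of N is
    larger than p i - l d and the whole row satisfies phi <= d.

    N is square because (i, l) |-> |p i - l d| maps R_J injectively to C_J when
    2 J <= p + 1, and onto C_J when 2 J >= p + 1: if x = p i - l d with l >= J, then
    x = (p - l) d - p (d - i). *)

Require Import Defs.
From mathcomp Require Import all_boot all_order all_fingroup all_algebra.
From mathcomp Require Import mpoly.
From mathcomp Require Import zify.

Set Implicit Arguments.
Unset Strict Implicit.
Unset Printing Implicit Defensive.

Import Order.TTheory GRing.Theory.
Local Open Scope ring_scope.

(** Take an element of [P] with the most elements of [P] below it: anything above it would have all
    of these below it, and also the element itself. *)
Lemma exists_maximal (T : finType) (lt : rel T) (P : pred T) (x0 : T) :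
  irreflexive lt -> transitive lt -> P x0 ->
  exists2 x, P x & forall y, P y -> ~~ lt x y.
Proof.
move=> lt_irr lt_tr Px0.
case: (@arg_maxnP _ x0 P (fun x => #|[set y | P y && lt y x]|) Px0) => x Px xmax.
exists x => // y Py; apply/negP => xy; have := xmax y Py; apply/negP.
rewrite -ltnNge; apply: proper_card; apply/properP; split.
  by apply/subsetP => z; rewrite !inE => /andP[-> zx]; exact: lt_tr zx xy.
by exists x; rewrite !inE Px // lt_irr.
Qed.

(** * Weighted matchings and exchange arguments *)

Section Matchings.

Variables (A B : finType) (d : nat) (h : A -> nat) (e : B -> nat).
Hypothesis card_AB : #|A| = #|B|.
Hypotheses (h_inj : injective h) (e_inj : injective e).
Hypothesis e_lt_h : forall r c, (e c < h r)%N.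

Definition exchange (s : {ffun A -> B}) (x y : A) : {ffun A -> B} :=
  [ffun z => s (tperm x y z)].

Lemma exchange_inj (s : {ffun A -> B}) x y :
  injective s -> injective (exchange s x y).
Proof. by move=> s_inj u v; rewrite !ffunE => /s_inj /perm_inj. Qed.

(** With row heights for [h] and column indices for [e], and [s] admissible, this is the exponent
    vector of LM(Pr(s)) without the common factor a_d^Lambda. *)
Definition profile (s : {ffun A -> B}) : 'X_{1..d.+1} :=
  [multinom #|[set r | (h r - e (s r))%N == l :> nat]| | l < d.+1].

(** Abstract form of the graph of [s] lying in T_N. *)
Definition admissible (s : {ffun A -> B}) : bool :=
  [forall r, h r - e (s r) <= d]%N.

Lemma preimage_of_inj (s : {ffun A -> B}) (c : B) :
  injective s -> exists r, s r = c.
Proof.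
move=> s_inj; have [g _ gK] : bijective s by apply: inj_card_bij; rewrite ?card_AB.
by exists (g c).
Qed.

(** The comparison is decided at exponent [l]: the counts above [l] agree, and every row of weight
    [l] under [s] keeps it under [t], which gains row [r]. *)
Lemma mlex_profile (s t : {ffun A -> B}) (l : nat) : (l <= d)%N ->
  (forall r, (l <= h r - e (s r))%N -> (h r - e (t r) = h r - e (s r))%N) ->
  (forall r, (l < h r - e (t r))%N -> (h r - e (t r) = h r - e (s r))%N) ->
  (exists2 r, (h r - e (t r) = l)%N & (h r - e (s r) <> l)%N) ->
  mlex_lt (profile s) (profile t).
Proof.
move=> ld st ts [r rt rs]; have ld1 : (l < d.+1)%N by [].
apply/existsP; exists (Ordinal ld1); rewrite !mnmE; apply/andP; split.
  apply: proper_card; apply/properP; split.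
    apply/subsetP => z; rewrite !inE => /eqP /= zl.
    by rewrite st // zl.
  by exists r; rewrite !inE /= ?rt ?eqxx //; apply/eqP.
apply/forallP => j; apply/implyP => /= lj; rewrite !mnmE; apply/eqP.
apply: eq_card => z; rewrite !inE; apply/eqP/eqP => /= zj.
  by rewrite st // zj // ltnW.
by rewrite -ts // zj.
Qed.

(* Maximal matchings are those produced by greedily matching the pairs of
   largest weight [h r - e c]: if the admissible [s] had a pair (r, c) that the
   maximal [s0] lacks, of largest weight among all pairs where they differ, then
   (r, s0 r) and (s0^-1 c, c) have smaller weights and exchanging their ends
   would increase the profile of [s0]. *)
Lemma unique_max_profile (s1 : {ffun A -> B}) :
  injective s1 -> admissible s1 ->
  exists s0 : {ffun A -> B},
    [/\ injective s0, admissible s0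
      & forall s : {ffun A -> B}, injective s -> s != s0 -> admissible s ->
          mlex_lt (profile s) (profile s0)].
Proof.
move=> s1_inj s1_adm.
have [||/=|s0 /andP[/injectiveP s0_inj s0_adm] s0_max] :=
  @exists_maximal {ffun A -> B} (fun s t => mlex_lt (profile s) (profile t))
    (fun s => injectiveb s && admissible s) s1.
- by move=> s; rewrite mlex_lt_irr.
- by move=> t s u; exact: mlex_lt_trans.
- by rewrite s1_adm andbT; apply/injectiveP.
exists s0; split=> // s s_inj ne s_adm.
pose w r c := (h r - e c)%N.
have w_injr r c c' : w r c = w r c' -> c = c'.
  by rewrite /w => E; apply: e_inj; have := e_lt_h r c; have := e_lt_h r c'; lia.
have w_injl r r' c : w r c = w r' c -> r = r'.
  by rewrite /w => E; apply: h_inj; have := e_lt_h r c; have := e_lt_h r' c; lia.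
pose D := [pred x : A * B | (s x.1 == x.2) != (s0 x.1 == x.2)].
have [r0 r0P] : exists r, s r != s0 r.
  apply/existsP; apply: contraNT ne; rewrite negb_exists => /forallP E.
  by apply/eqP/ffunP => r; apply/eqP; rewrite -[_ == _]negbK E.
have D0 : D (r0, s r0) by rewrite /D /= eqxx eq_sym [s0 _ == _]eq_sym (negbTE r0P).
case: (@arg_maxnP _ (r0, s r0) D (fun x => w x.1 x.2) D0) => -[a b] Dab wmax.
(* [l] is the largest weight of a pair lying in exactly one of the graphs of [s] and [s0]. *)
set l := w a b in wmax.
have wle r c : (s r == c) != (s0 r == c) -> (w r c <= l)%N.
  by move=> Drc; exact: (wmax (r, c)).
have s0_no_lack r : s r != s0 r -> w r (s r) <> l.
  move=> sr E; set c := s r in sr E.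
  have [r2 r2c] := preimage_of_inj c s0_inj.
  have r2r : r2 != r by apply: contra_neq sr => <-.
  have ld : (l <= d)%N by rewrite -E; exact: (forallP s_adm r).
  have lt1 : (w r (s0 r) < l)%N.
    rewrite ltn_neqAle wle ?eqxx ?(negbTE sr) // andbT -E.
    by apply: contra_neq sr => /w_injr.
  have lt2 : (w r2 c < l)%N.
    rewrite ltn_neqAle wle; last by rewrite r2c eqxx /c (inj_eq s_inj) (negbTE r2r).
    by rewrite andbT -E; apply: contra_neq r2r => /w_injl.
  (* By [lt1], e (s0 r) > e c, so column [s0 r] weighs less than [c] in row [r2] too, and w r2 c <
     l. *)
  have lt3 : (w r2 (s0 r) < l)%N.
    move: lt1 lt2; rewrite -E /w.
    by have := e_lt_h r c; have := e_lt_h r2 c; lia.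
  have exr : exchange s0 r r2 r = c by rewrite ffunE tpermL.
  have exr2 : exchange s0 r r2 r2 = s0 r by rewrite ffunE tpermR.
  have exz z : z != r -> z != r2 -> exchange s0 r r2 z = s0 z.
    by move=> zr zr2; rewrite ffunE tpermD // eq_sym.
  have exP : injectiveb (exchange s0 r r2) && admissible (exchange s0 r r2).
    apply/andP; split; first exact/injectiveP/exchange_inj.
    apply/forallP => z; have [->|zr] := eqVneq z r; first by rewrite exr -/(w r c) E.
    have [->|zr2] := eqVneq z r2; first by rewrite exr2 (leq_trans (ltnW lt3)).
    by rewrite exz //; exact: (forallP s0_adm).
  move/negP: (s0_max _ exP); apply; apply: (mlex_profile ld); last by exists r; rewrite ?exr //; apply/eqP; rewrite ltn_eqF.
    move=> z lz; rewrite exz //; apply: contraTneq lz => ->; rewrite -ltnNge //.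
    by rewrite r2c.
  move=> z lz; rewrite exz //; apply: contraTneq lz => ->; rewrite -leqNgt.
    by rewrite exr -/(w r c) E.
  by rewrite exr2 ltnW.
(* So the pairs of [s] of weight at least [l] all lie in [s0], and the differing pair (a, b) belongs
   to [s0] alone: the profiles are decided at [l] in favour of [s0]. *)
have s_eq r : (l <= w r (s r))%N -> s r = s0 r.
  move=> lr; apply/eqP; apply: contraT => sr.
  have : (w r (s r) <= l)%N by apply: wle; rewrite eqxx [s0 r == _]eq_sym (negbTE sr).
  by move=> le; case: (s0_no_lack r sr); apply/eqP; rewrite eqn_leq le.
have s0b : s0 a = b /\ s a <> b.
  move: Dab; rewrite /D /=; case: (eqVneq (s a) b) => [sab|sab].
    case: (eqVneq (s0 a) b) => // s0ab _; by case: (s0_no_lack a); rewrite ?sab // eq_sym.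
  by case: (eqVneq (s0 a) b) => // s0ab _; split=> //; apply/eqP.
case: s0b => s0ab sab.
apply: (@mlex_profile _ _ l).
- by rewrite /l -s0ab; exact: (forallP s0_adm a).
- by move=> r lr; rewrite s_eq.
- move=> r lr; have [-> //|sr] := eqVneq (s r) (s0 r).
  have : (w r (s0 r) <= l)%N by apply: wle; rewrite eqxx (negbTE sr).
  by rewrite leqNgt lr.
- by exists a; rewrite ?s0ab // => /w_injr; exact: sab.
Qed.

(* An injection with the largest number of pairs of weight [d] is admissible. *)
Lemma exists_admissible :
  (forall r, (exists c, h r - e c = d)%N \/ (forall c, h r - e c <= d)%N) ->
  exists2 s : {ffun A -> B}, injective s & admissible s.
Proof.
move=> H; pose s0 : {ffun A -> B} :=
  [ffun r => enum_val (cast_ord card_AB (enum_rank r))].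
have s0_inj : injective s0.
  by move=> x y; rewrite !ffunE => /enum_val_inj /cast_ord_inj /enum_rank_inj.
have s0P : injectiveb s0 by apply/injectiveP.
case: (@arg_maxnP _ s0 (fun s => injectiveb s)
  (fun s : {ffun A -> B} => #|[set r | h r - e (s r) == d]|%N) s0P) => s.
move=> /injectiveP s_inj smax; exists s => //; apply/forallP => r.
case: (H r) => // -[c rc]; have [->|src] := eqVneq (s r) c; first by rewrite rc.
(* Give [c] to row [r] and [s r] to the row [r2] that held [c]. Row [r] gains weight [d], which it
   lacked as [e] is injective; row [r2] did not have weight [d] at [c] as [h] is injective. The
   count increases, a contradiction. *)
have [r2 r2c] := preimage_of_inj c s_inj.
have r2r : r2 != r by apply: contra_neq src => <-.
have exP : injectiveb (exchange s r r2) by apply/injectiveP/exchange_inj.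
have /= := smax _ exP; rewrite leqNgt => /negP[].
apply: proper_card; apply/properP; split; last first.
  exists r; rewrite !inE ?ffunE ?tpermL ?r2c ?rc ?eqxx //.
  apply: contra_neqN src => /eqP E; apply: e_inj.
  by have := e_lt_h r c; have := e_lt_h r (s r); lia.
apply/subsetP => z; rewrite !inE ffunE => /eqP zd; apply/eqP.
case: tpermP => [zr|zr|//]; last first.
  exfalso; move/eqP: r2r; apply; apply: h_inj; move: zd; rewrite zr r2c.
  by have := e_lt_h r c; have := e_lt_h r2 c; lia.
by rewrite r2c zr.
Qed.

End Matchings.

(** * Leading monomials of products *)

Section LeadingMonomial.

Variables (k : fieldType) (n : nat).
Implicit Types (m : 'X_{1..n}) (g : {mpoly k[n]}).

Lemma mlex_ltD m1 m2 m : mlex_lt (m1 + m)%MM (m2 + m)%MM = mlex_lt m1 m2.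
Proof.
rewrite /mlex_lt; apply: eq_existsb => i; rewrite !mnmDE ltn_add2r.
by congr (_ && _); apply: eq_forallb => j; rewrite !mnmDE eqn_add2r.
Qed.

Lemma LM_eq m g : m \in msupp g ->
  (forall m', m' \in msupp g -> m' != m -> mlex_lt m' m) -> LM g = m.
Proof.
move=> mg mmax; have g0 : g != 0 by apply: contraTneq mg => ->; rewrite msupp0.
have [Lg Lmax] := LMP g0; apply/eqP; apply: contraT => ne.
have := mlex_lt_trans (mmax _ Lg ne) (Lmax _ mg _).
by rewrite mlex_lt_irr => ->//; rewrite eq_sym.
Qed.

Lemma LM1 : LM (1 : {mpoly k[n]}) = 0%MM.
Proof.
by apply: LM_eq; rewrite msupp1 ?inE // => m; rewrite inE => /eqP -> /eqP.
Qed.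

Lemma mcoeff_gt_LM m g : mlex_lt (LM g) m -> g@_m = 0.
Proof.
have [->|g0] := eqVneq g 0; first by rewrite mcoeff0.
move=> lt; apply/eqP; rewrite mcoeff_eq0; apply/negP => mg.
have [_ Lmax] := LMP g0; have ne : m != LM g.
  by apply: contraTneq lt => ->; rewrite mlex_lt_irr.
by have := mlex_lt_trans lt (Lmax _ mg ne); rewrite mlex_lt_irr.
Qed.

Lemma mlex_ltD2 m1 m2 m1' m2' :
  (m1 == m1') || mlex_lt m1 m1' -> (m2 == m2') || mlex_lt m2 m2' ->
  (m1 + m2 != m1' + m2')%MM -> mlex_lt (m1 + m2)%MM (m1' + m2')%MM.
Proof.
case: eqVneq => [->|_] /=; case: (eqVneq m2 m2') => [->|_] //=.
- by rewrite eqxx.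
- by rewrite ![(m1' + _)%MM]addmC mlex_ltD.
- by rewrite mlex_ltD.
move=> lt1 lt2 _; apply: (@mlex_lt_trans _ (m1' + m2)%MM).
  by rewrite mlex_ltD.
by rewrite ![(m1' + _)%MM]addmC mlex_ltD.
Qed.

(** The order is invariant under translation, so in the convolution for the coefficient at LM g1 +
    LM g2 a single term survives, a product of two nonzero scalars. *)
Lemma LMM g1 g2 : g1 != 0 -> g2 != 0 -> LM (g1 * g2) = (LM g1 + LM g2)%MM.
Proof.
move=> g10 g20; have [L1 max1] := LMP g10; have [L2 max2] := LMP g20.
have le1 m : m \in msupp g1 -> (m == LM g1) || mlex_lt m (LM g1).
  by move=> /max1; case: eqVneq => //= _; apply.
have le2 m : m \in msupp g2 -> (m == LM g2) || mlex_lt m (LM g2).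
  by move=> /max2; case: eqVneq => //= _; apply.
apply: LM_eq; last first.
  move=> m /msuppM_le /allpairsP[[m1 m2] /= [m1g m2g ->]].
  by apply: mlex_ltD2; [exact: le1 | exact: le2].
rewrite mcoeff_msupp; move EM: (LM g1 + LM g2)%MM => M; rewrite mcoeffM.
(* The sum in [mcoeffM] runs over monomials of degree at most mdeg M; both leading monomials are in
   range. *)
have lt1 : (mdeg (LM g1) < (mdeg M).+1)%N by rewrite -EM mdegD ltnS leq_addr.
have lt2 : (mdeg (LM g2) < (mdeg M).+1)%N by rewrite -EM mdegD ltnS leq_addl.
rewrite (bigD1 (BMultinom lt1, BMultinom lt2)); last by rewrite /= EM.
rewrite /= big1 ?addr0; first by rewrite mulf_neq0 // -mcoeff_msupp.
move=> -[u v] /andP[/eqP Muv]; rewrite -pair_eqE /pair_eq -!val_eqE /= => ne.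
have {Muv}: M = (u + v)%MM by [].
move: (u : 'X_{1..n}) (v : 'X_{1..n}) ne => {}u {}v ne Muv.
apply/eqP; rewrite mulf_eq0 !mcoeff_eq0.
rewrite -negb_and; apply: contra ne => /andP[ug vg].
have Luv : (LM g1 + LM g2 = u + v)%MM by rewrite EM.
have vM : LM g1 = u -> LM g2 = v by move=> E; move: Luv; rewrite E => /addmI.
case/orP: (le1 _ ug) => [/eqP E|ltu].
  by rewrite -E vM ?eqxx.
(* With u < LM g1 one gets M = u + v < LM g1 + v <= LM g1 + LM g2 = M. *)
have /negP[] : ~~ mlex_lt M M by rewrite mlex_lt_irr.
rewrite [X in mlex_lt X]Muv; apply: (@mlex_lt_trans _ (LM g1 + v)%MM).
  by rewrite mlex_ltD.
case/orP: (le2 _ vg) => [/eqP E|ltv]; last first.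
  by rewrite -EM ![(LM g1 + _)%MM]addmC mlex_ltD.
move: Luv; rewrite E => /addIm E'.
by move: ltu; rewrite E' mlex_lt_irr.
Qed.

Lemma LM_prod (I : Type) (r : seq I) (F : I -> {mpoly k[n]}) :
  (forall i, F i != 0) ->
  LM (\prod_(i <- r) F i) = (\sum_(i <- r) LM (F i))%MM.
Proof.
move=> F0; elim: r => [|i r IH]; first by rewrite !big_nil LM1.
rewrite !big_cons LMM ?IH //.
by elim/big_rec: _ => [|j q _ q0]; rewrite ?oner_eq0 ?mulf_neq0.
Qed.

End LeadingMonomial.

(** * The index sets and the squareness of N *)

Section IndexSets.

Variables (p d : nat).
Hypotheses (p_prime : prime p) (p_ndvd_d : ~~ (p %| d)%N).

Let p_gt0 : (0 < p)%N. Proof. exact: prime_gt0. Qed.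

Lemma ndvd_muld l : (0 < l < p)%N -> ~~ (p %| l * d)%N.
Proof.
move=> /andP[l0 lp]; rewrite Euclid_dvdM // (negbTE p_ndvd_d) orbF.
by rewrite gtnNdvd.
Qed.

(** The equation is p i - l d = p i' - l' d without subtraction; since d is invertible modulo p, it
    determines l modulo p. *)
Lemma eq_mod_residue i l i' l' : (l < p)%N -> (l' < p)%N ->
  (p * i + l' * d = p * i' + l * d)%N -> (i = i') /\ (l = l').
Proof.
have aux a b u v : (b < p)%N -> (p * u + b * d = p * v + a * d)%N -> (b <= a)%N.
  move=> bp E; rewrite leqNgt; apply/negP => ab.
  have /negP[] : ~~ (p %| (b - a) * d)%N by apply: ndvd_muld; lia.
  apply/dvdnP; exists (v - u)%N; rewrite mulnBl.
  have : (a * d <= b * d)%N by rewrite leq_mul2r (ltnW ab) orbT.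
  by nia.
move=> lp l'p E; have ll : l = l'.
  by apply/eqP; rewrite eqn_leq (aux _ _ _ _ l'p E) (aux _ _ _ _ lp (esym E)).
split=> //; move: E; rewrite ll => /addIn /eqP.
by rewrite eqn_pmul2l // => /eqP.
Qed.

(** Bezout gives [a] with a d = -1 modulo p; take l = x a mod p, nonzero because p does not divide
    x. *)
Lemma exists_residue x : ~~ (p %| x)%N ->
  exists2 l, (0 < l < p)%N & (p %| x + l * d)%N.
Proof.
move=> px; have [a _] := Bezoutl d p_gt0.
have /eqP -> : coprime p d by rewrite prime_coprime.
move=> pa; have pl : (p %| x + (x * a) %% p * d)%N.
  rewrite /dvdn -modnDmr modnMml modnDmr -mulnA.
  by rewrite -{1}[x]muln1 -mulnDr -/(dvdn _ _) dvdn_mull.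
exists ((x * a) %% p)%N => //; rewrite ltn_mod p_gt0 andbT lt0n.
by apply: contraNneq px => E; move: pl; rewrite E addn0.
Qed.

Variable J : nat.
Hypothesis J_bounds : (1 < J < p)%N.

Let J_ltp : (J < p)%N. Proof. by case/andP: J_bounds. Qed.

Lemma RJE i l : ((i, l) \in RJ p d J) =
  [&& (0 < l < J)%N, ((p * l - J + 1) * d < p ^ 2 * i)%N
    & (p ^ 2 * i < (p * (l + 1) - J) * d)%N].
Proof.
apply/idP/idP => [|H]; first by rewrite mem_sort mem_filter inRE // => /andP[].
have : inR p d J i l by rewrite inRE.
by case/mem_RJ => // -[i1 l1] H1 /= [[->] [->]].
Qed.

Lemma CJE x : (x \in CJ p d J) =
  [&& (0 < x)%N, (p * x < (p - J) * d)%N & ~~ (p %| x)%N].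
Proof.
apply/idP/idP => [|H]; first by rewrite mem_filter inCE ?(ltnW J_ltp) // => /andP[].
have : inC p d J x by rewrite inCE // ltnW.
by case/mem_CJ => // y yC [->].
Qed.

Lemma RN_sub x : x \in RN p d J -> x \in RJ p d J.
Proof. by rewrite /RN; case: ifP => // _ /mem_take. Qed.

Lemma CN_sub x : x \in CN p d J -> x \in CJ p d J.
Proof. by rewrite /CN; case: ifP => // _ /mem_drop. Qed.

(** C_N is a final segment of C_J in both cases of its definition. *)
Lemma CN_upward_closed x y :
  x \in CN p d J -> y \in CJ p d J -> (x <= y)%N -> y \in CN p d J.
Proof.
rewrite /CN; case: ifP => // _; set q := (_ - _)%N => xC yC.
have := CJ_sorted p d J; rewrite -{1}(cat_take_drop q (CJ p d J)).
rewrite sorted_pairwise; last exact: ltn_trans.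
rewrite pairwise_cat => /and3P[/allrelP H _ _] xy.
move: yC; rewrite -{1}(cat_take_drop q (CJ p d J)) mem_cat => /orP[yT|//].
by have /= := H _ _ yT xC; rewrite ltnNge xy.
Qed.

Lemma CN_uniq : uniq (CN p d J).
Proof.
have u : uniq (CJ p d J) by exact: (sorted_uniq ltn_trans ltnn (CJ_sorted p d J)).
by rewrite /CN; case: ifP => // _; exact: drop_uniq.
Qed.

Lemma RJ_uniq : uniq (RJ p d J).
Proof.
have := RJ_sorted d p_gt0 J_ltp => /(sorted_uniq ltn_trans ltnn).
exact: map_uniq.
Qed.

Lemma RN_uniq : uniq (RN p d J).
Proof. by rewrite /RN; case: ifP => _; rewrite ?take_uniq ?RJ_uniq. Qed.

(** The upper bound on i in R_J is exactly the bound p x < (p - J) d for x = p i - l d. *)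
Lemma diff_in_CJ i l : (i, l) \in RJ p d J -> (l * d < p * i)%N ->
  (p * i - l * d)%N \in CJ p d J.
Proof.
rewrite RJE CJE => /and3P[/andP[l0 lJ] _ H] lt; apply/and3P; split.
- by rewrite subn_gt0.
- rewrite mulnBr ltn_subLR.
    rewrite mulnA mulnn; apply: leq_trans H _; rewrite mulnA -mulnDl leq_mul2r; apply/orP; right.
    by nia.
  by rewrite leq_mul2l (ltnW lt) orbT.
- rewrite dvdn_subr ?(ltnW lt) //; last exact: dvdn_mulr.
  by rewrite ndvd_muld // l0 (ltn_trans lJ).
Qed.

(** The lower bound on i in R_J reads p (l d - p i) < (J - 1) d, and J - 1 <= p - J. *)
Lemma opp_diff_in_CJ i l : (2 * J <= p + 1)%N -> (i, l) \in RJ p d J ->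
  (p * i < l * d)%N -> (l * d - p * i)%N \in CJ p d J.
Proof.
rewrite RJE CJE => J2 /and3P[/andP[l0 lJ] H _] lt; apply/and3P; split.
- by rewrite subn_gt0.
- rewrite mulnBr ltn_subLR; last by rewrite leq_mul2l (ltnW lt) orbT.
  apply: (@leq_ltn_trans ((p * l - J + 1) * d + (p - J) * d)).
    rewrite mulnA -mulnDl leq_mul2r; apply/orP; right.
    by nia.
  by rewrite mulnA ltn_add2r mulnn.
- rewrite dvdn_subl ?(ltnW lt) //; last exact: dvdn_mulr.
  by rewrite ndvd_muld // l0 (ltn_trans lJ).
Qed.

Lemma RJ_neq i l : (i, l) \in RJ p d J -> (p * i)%N != (l * d)%N.
Proof.
rewrite RJE => /and3P[/andP[l0 lJ] _ _].
apply: contraNneq (ndvd_muld (l := l) _) => [<-|]; first exact: dvdn_mulr.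
by rewrite l0 (ltn_trans lJ).
Qed.

(** The sum [f] of the two truncated differences is |p i - l d|. Two values with opposite signs
    cannot agree: p (i + i') = (l + l') d is impossible because 0 < l + l' <= 2 (J - 1) < p. *)
Lemma size_RJ_le : (2 * J <= p + 1)%N -> (size (RJ p d J) <= size (CJ p d J))%N.
Proof.
move=> J2; pose f (x : nat * nat) := (p * x.1 - x.2 * d + (x.2 * d - p * x.1))%N.
rewrite -(size_map f); apply: uniq_leq_size; last first.
  move=> _ /mapP[[i l] H ->]; rewrite /f /=.
  have := RJ_neq H; rewrite neq_ltn => /orP[lt|lt].
    have -> : (p * i - l * d = 0)%N by lia.
    by rewrite add0n opp_diff_in_CJ.
  have -> : (l * d - p * i = 0)%N by lia.
  by rewrite addn0 diff_in_CJ.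
rewrite map_inj_in_uniq ?RJ_uniq // => -[i l] [i' l'] H H'; rewrite /f /= => E.
have nH := RJ_neq H; have nH' := RJ_neq H'.
have := H; rewrite RJE => /and3P[/andP[l0 lJ] _ _].
have := H'; rewrite RJE => /and3P[/andP[l'0 l'J] _ _].
have [lp l'p] : (l < p)%N /\ (l' < p)%N by split; lia.
have llp : (0 < l + l' < p)%N by lia.
have /negP nd := ndvd_muld llp; rewrite mulnDl in nd.
have [E1|[E1|E1]] : (p * i + l' * d = p * i' + l * d \/
   p * i + p * i' = l * d + l' * d \/ p * i + p * i' = l * d + l' * d)%N by lia.
- by have [-> ->] := eq_mod_residue lp l'p E1.
- by case: nd; rewrite -E1 -mulnDr dvdn_mulr.
- by case: nd; rewrite -E1 -mulnDr dvdn_mulr.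
Qed.

Lemma size_CJ_le : (p + 1 <= 2 * J)%N -> (size (CJ p d J) <= size (RJ p d J))%N.
Proof.
move=> J2; pose f (x : nat * nat) := (p * x.1 - x.2 * d + (x.2 * d - p * x.1))%N.
rewrite -(size_map f (RJ _ _ _)); apply: uniq_leq_size.
  exact: (sorted_uniq ltn_trans ltnn (CJ_sorted p d J)).
move=> x; rewrite CJE => /and3P[x0 xlt px].
have [l /andP[l0 lp] /dvdnP[i Ei]] := exists_residue px.
have d0 : (0 < d)%N by case: (d) p_ndvd_d => //; rewrite dvdn0.
(* The relation x = p i - l d, multiplied by p so that the bounds defining R_J apply. *)
have pEi : (p * x + (p * l) * d = p ^ 2 * i)%N by nia.
have idlt : (i < d)%N.
  have : (p ^ 2 * i < p ^ 2 * d)%N.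
    by rewrite -pEi; nia.
  by rewrite ltn_pmul2l // expn_gt0 p_gt0.
apply/mapP; have [lJ|Jl] := ltnP l J.
  exists (i, l); last by rewrite /f /=; lia.
  rewrite RJE l0 lJ -pEi /=.
  have E1 : ((p * l - J + 1) * d <= p * l * d)%N by rewrite leq_mul2r; apply/orP; right; nia.
  have E2 : ((p * (l + 1) - J) * d = (p - J) * d + p * l * d)%N.
    by rewrite -mulnDl; congr (_ * d)%N; nia.
  by rewrite E2 ltn_add2r xlt andbT; nia.
(* This reflection changes the sign of p i - l d. From 2 J >= p + 1 come p - l < J and p x < (p - J)
   d <= (J - 1) d, which is the lower bound of R_J. *)
exists (d - i, p - l)%N; last first.
  rewrite /f /= mulnBr mulnBl.
  have : (l * d <= p * d)%N by rewrite leq_mul2r (ltnW lp) orbT.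
  have : (p * i <= p * d)%N by rewrite leq_mul2l (ltnW idlt) orbT.
  by lia.
rewrite RJE; apply/and3P; split; first by lia.
  rewrite [(p ^ 2 * _)%N]mulnBr -pEi ltn_subRL.
  have E1 : (p * x + (p * l * d + (p * (p - l) - J + 1) * d) < (p - J) * d + (p * l * d + (p * (p - l) - J + 1) * d))%N.
    by rewrite ltn_add2r.
  rewrite -addnA; apply: leq_trans E1 _; rewrite -!mulnDl leq_mul2r; apply/orP; right.
  by nia.
rewrite [(p ^ 2 * _)%N]mulnBr -pEi ltn_subLR; last first.
  by rewrite pEi leq_mul2l (ltnW idlt) orbT.
apply: (@leq_trans (p * x + p ^ 2 * d)); first by nia.
rewrite -addnA leq_add2l -mulnDl leq_mul2r; apply/orP; right.
by nia.
Qed.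

Lemma size_RN_CN : size (RN p d J) = size (CN p d J).
Proof.
rewrite /RN /CN; case: leqP => J2; first by rewrite size_drop subKn // size_RJ_le.
by rewrite size_takel // size_CJ_le // ltnW.
Qed.

Lemma RN_weight i l : (i, l) \in RN p d J ->
  (exists2 y, y \in CN p d J & p * i = l * d + y)%N \/
  (forall y, y \in CN p d J -> p * i - y <= l * d)%N.
Proof.
move=> /RN_sub H.
have [|N] := boolP ((p * i - l * d)%N \in CN p d J).
  move=> E; left; exists (p * i - l * d)%N => //; rewrite subnKC //.
  by move/CN_sub: E; rewrite CJE subn_gt0 => /and3P[/ltnW].
(* A column y with l d < p i - y is smaller than p i - l d, so upward closure would put p i - l d
   into C_N. *)
right=> y yC; rewrite leqNgt; apply: contra N => lt.
by apply: (CN_upward_closed yC); first apply: diff_in_CJ => //; lia.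
Qed.

End IndexSets.

(** * Coefficients of the powers of f *)

Section CoefficientsOfPowers.

Variables (k : fieldType) (d : nat).

Lemma bcoef0 n : bcoef k d 0 n = (n == 0)%:R.
Proof. by rewrite /bcoef expr0 coef1. Qed.

Lemma bcoefS l n :
  bcoef k d l.+1 n = \sum_(i < d.+1 | (i <= n)%N) 'X_i * bcoef k d l (n - i).
Proof.
rewrite /bcoef exprS /genpoly mulr_suml coef_sum [RHS]big_mkcond.
apply: eq_bigr => i _; rewrite -mulrA coefCM coefXnM.
by case: ltnP => _ //; rewrite mulr0.
Qed.

Lemma mcoeffXM (i : 'I_d.+1) (q : {mpoly k[d.+1]}) m :
  ('X_i * q)@_(m + U_(i)) = q@_m.
Proof. by rewrite mulrC addmC mcoeffMX. Qed.

Lemma mcoeffXM_eq0 (i : 'I_d.+1) (q : {mpoly k[d.+1]}) (m : 'X_{1..d.+1}) :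
  m i = 0%N -> ('X_i * q)@_m = 0.
Proof.
move=> mi; apply/eqP; rewrite mcoeff_eq0; apply/negP => /msuppM_le.
case/allpairsP=> -[u v] /= [uX _ E]; move: mi uX; rewrite msuppX inE E.
by rewrite mnmDE => uv /eqP E'; move: uv; rewrite E' mnm1E eqxx.
Qed.

(** Each of the l factors f contributes one variable a_i together with x^i. *)
Lemma msupp_bcoef l n m : m \in msupp (bcoef k d l n) ->
  mdeg m = l /\ (\sum_(i < d.+1) m i * i = n)%N.
Proof.
elim: l n m => [|l IH] n m.
  rewrite bcoef0; case: eqP => [->|_]; last by rewrite msupp0.
  rewrite msupp1 inE => /eqP ->; rewrite mdeg0; split=> //.
  by rewrite big1 // => i _; rewrite mnm0E.
rewrite bcoefS => /msupp_sum_le /flatten_mapP [i].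
rewrite mem_filter => /andP[ile _] /msuppM_le /allpairsP [[u v] /= [uX vb ->]].
move: uX; rewrite msuppX inE => /eqP ->; have [<- vn] := IH _ _ vb.
rewrite mdegD mdeg1; split=> //.
rewrite (eq_bigr (fun j : 'I_d.+1 => (i == j) * j + v j * j)%N); last first.
  by move=> j _; rewrite mnmDE mnm1E mulnDl.
rewrite big_split /= vn (bigD1 i) //= eqxx mul1n big1 ?addn0 ?subnKC //.
by move=> j ne; rewrite eq_sym (negbTE ne).
Qed.

Lemma bcoef_eq0 l n : (l * d < n)%N -> bcoef k d l n = 0.
Proof.
move=> ln; apply/eqP; rewrite -msupp_eq0; case E: (msupp _) => [//|m s].
have : m \in msupp (bcoef k d l n) by rewrite E inE eqxx.
case/msupp_bcoef => ml mn; move: ln; rewrite ltnNge -mn -ml mdegE big_distrl.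
by case/negP; apply: leq_sum => i _; rewrite leq_mul2l -ltnS ltn_ord orbT.
Qed.

Lemma mcoeff_bcoef_max l : (bcoef k d l (l * d))@_(U_(ord_max) *+ l) = 1.
Proof.
elim: l => [|l IH]; first by rewrite bcoef0 eqxx mulm0n mcoeff1 eqxx.
rewrite bcoefS raddf_sum (bigD1 ord_max) /=; last by rewrite mulSn leq_addr.
rewrite mulSn addKn mulmS addmC mcoeffXM IH big1 ?addr0 // => i /andP[_ ne].
rewrite bcoef_eq0 ?mulr0 ?mcoeff0 //.
have : (i < d)%N by rewrite ltn_neqAle -ltnS ltn_ord andbT.
lia.
Qed.

(** The coefficient counts the factor, among l + 1, that supplies a_i while the others supply a_d.
    In the induction the new factor supplies either a_i, leaving a_d^l, or a_d. *)
Lemma mcoeff_bcoef_lead l (i : 'I_d.+1) : i != ord_max ->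
  (bcoef k d l.+1 (i + l * d))@_(U_(i) + U_(ord_max) *+ l) = l.+1%:R.
Proof.
move=> ne; have id : (i < d)%N by rewrite ltn_neqAle -ltnS ltn_ord andbT.
elim: l => [|l IH].
  rewrite bcoefS raddf_sum (bigD1 i) /=; last by rewrite addn0.
  rewrite mul0n mulm0n addn0 subnn bcoef0 eqxx mulr1 addm0 mcoeffXU eqxx.
  rewrite big1 ?addr0 // => j /andP[ji nej]; rewrite bcoef0.
  by rewrite subn_eq0 leqNgt ltn_neqAle ji andbT val_eqE nej mulr0 mcoeff0.
rewrite bcoefS raddf_sum (bigD1 i) /=; last by rewrite leq_addr.
rewrite addKn addmC mcoeffXM mcoeff_bcoef_max.
rewrite (bigD1 ord_max) /=; last by rewrite eq_sym ne andbT mulSn; lia.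
have -> : (i + l.+1 * d - d = i + l * d)%N by rewrite mulSn; lia.
rewrite mulmS [(U_(ord_max) + _)%MM]addmC -addmA [(U_(ord_max) + _)%MM]addmC addmA.
rewrite mcoeffXM [(_ + U_(i))%MM]addmC IH big1 ?addr0 -?natr1 1?addrC //.
move=> j /andP[/andP[_ nej] nejd]; apply: mcoeffXM_eq0.
by rewrite !mnmDE mulmnE !mnm1E !(eq_sym _ j) (negbTE nej) (negbTE nejd).
Qed.

Lemma lead_in_msupp_bcoef l (i : 'I_d.+1) : l.+1%:R != 0 :> k ->
  (U_(i) + U_(ord_max) *+ l)%MM \in msupp (bcoef k d l.+1 (i + l * d)).
Proof.
move=> l0; rewrite mcoeff_msupp; have [->|ne] := eqVneq i ord_max.
  by rewrite -mulmS -mulSn mcoeff_bcoef_max oner_eq0.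
by rewrite mcoeff_bcoef_lead.
Qed.

(* A monomial of [b_{l, n}] has degree [l] and weight [n], so its exponent at
   [a_d] is less than [l] unless it is [a_d ^ l]. *)
Lemma LM_bcoef l (i : 'I_d.+1) : (0 < i)%N -> l.+1%:R != 0 :> k ->
  LM (bcoef k d l.+1 (i + l * d)) = (U_(i) + U_(ord_max) *+ l)%MM.
Proof.
move=> i0 l0; apply: LM_eq; first exact: lead_in_msupp_bcoef.
move=> m /msupp_bcoef [ml mn] ne.
have /orP[//|/existsP[j /andP[jlt /forallP jeq]]] := mlex_lt_total ne.
have {}jeq (u : 'I_d.+1) : (j < u)%N -> m u = (U_(i) + U_(ord_max) *+ l)%MM u.
  by move=> ju; rewrite (eqP (implyP (jeq u) ju)).
move: jlt jeq; rewrite mnmDE mulmnE !mnm1E => jlt jeq; exfalso.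
have sum2 (F : 'I_d.+1 -> nat) u v : u != v -> (F u + F v <= \sum_u F u)%N.
  by move=> uv; rewrite (bigD1 u) // (bigD1 v) 1?eq_sym //= addnA leq_addr.
have le1 u : (m u <= l.+1)%N by rewrite -ml mdegE (bigD1 u) //= leq_addr.
have jltd : j != ord_max -> (j < d)%N.
  by move=> jd; rewrite ltn_neqAle -ltnS ltn_ord andbT.
(* A larger exponent at a_d forces a_d^(l+1); this is the monomial itself if i = d, and has too
   large a weight if i < d. *)
have [jd|jd] := eqVneq j ord_max.
  have := le1 j; move: jlt; rewrite jd eqxx mul1n.
  have [_|ni mj mj'] := eqVneq i ord_max; first by lia.
  have : (m ord_max * d <= i + l * d)%N by rewrite -mn (bigD1 ord_max) //= leq_addr.
  have -> : m ord_max = l.+1 by lia.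
  have : (i < d)%N by rewrite ltn_neqAle -ltnS ltn_ord andbT.
  by rewrite mulSn; lia.
have md := jeq ord_max (jltd jd); rewrite mnmDE mulmnE !mnm1E eqxx mul1n in md.
have := sum2 m j ord_max jd; rewrite -mdegE ml md.
have := sum2 (fun u => m u * u)%N j ord_max jd; rewrite mn md /=.
move: jlt; rewrite eq_sym [_ == j]eq_sym (negbTE jd) mul0n addn0.
(* The exponents of a_d now agree. An additional a_j makes the weight too large if i < j, and the
   degree too large if j <= i. *)
case: (ltngtP i j) => ij.
- have -> /= : (i == ord_max) = false.
    by apply/eqP => E; move: ij; rewrite E ltnNge /= ltnW ?jltd.
  by nia.
- move=> mj _ _; have ne_ji : j != i by rewrite neq_ltn ij.
  have := jeq i ij; rewrite mnmDE mulmnE !mnm1E eqxx => mi.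
  have [id|id] := eqVneq i ord_max.
    by have := sum2 m j i ne_ji; rewrite -mdegE ml mi id eqxx; lia.
  have := ml; rewrite mdegE (bigD1 ord_max) //= (bigD1 i) //= (bigD1 j) /=; last first.
    by rewrite jd ne_ji.
  by move: mj; rewrite md mi (negbTE id) (negbTE ne_ji); lia.
- have -> : j = i by exact: val_inj.
  by rewrite eqxx; lia.
Qed.

End CoefficientsOfPowers.

(** * Entries, products and determinant of N *)

Section SquareSubmatrix.

Variables (k : fieldType) (p d J : nat).
Hypotheses (p_prime : prime p) (charkp : p \in [pchar k]).
Hypotheses (p_ndvd_d : ~~ (p %| d)%N).
Hypothesis J_bounds : (1 < J < p)%N.

Notation rowT := 'I_(size (RN p d J)).
Notation colT := 'I_(size (CN p d J)).

Let p_gt0 : (0 < p)%N. Proof. exact: prime_gt0. Qed.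
Let J_ltp : (J < p)%N. Proof. by case/andP: J_bounds. Qed.

Lemma rowN_RN (r : rowT) : rowN r \in RN p d J.
Proof. exact: mem_tnth. Qed.

Lemma rowN_RJ (r : rowT) : ((rowN r).1, (rowN r).2) \in RJ p d J.
Proof. by rewrite -surjective_pairing; apply: RN_sub; exact: rowN_RN. Qed.

Lemma colN_CN (c : colT) : colN c \in CN p d J.
Proof. exact: mem_tnth. Qed.

Lemma lambda_bounds (r : rowT) : (0 < (rowN r).2 < p)%N.
Proof.
have := rowN_RJ r; rewrite RJE // => /and3P[/andP[-> lJ] _ _].
exact: ltn_trans J_ltp.
Qed.

Lemma rowN_colN_lt (r : rowT) (c : colT) :
  (((rowN r).2 - 1) * d + colN c < p * (rowN r).1)%N.
Proof. by apply: (RJ_CJ_lt p_gt0 J_ltp (rowN_RJ r)); exact/CN_sub/colN_CN. Qed.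

Definition height (r : rowT) : nat := (p * (rowN r).1 - ((rowN r).2 - 1) * d)%N.

Lemma phiE (r : rowT) (c : colT) : phi r c = (height r - colN c)%N.
Proof. by rewrite /phi /degN /height subnAC. Qed.

Lemma colN_lt_height (r : rowT) (c : colT) : (colN c < height r)%N.
Proof. by rewrite /height ltn_subRL rowN_colN_lt. Qed.

Lemma degNE (r : rowT) (c : colT) :
  degN r c = (phi r c + ((rowN r).2 - 1) * d)%N.
Proof. by rewrite /phi subnK // /degN; have := rowN_colN_lt r c; lia. Qed.

Lemma inTNE (r : rowT) (c : colT) : inTN r c = (phi r c <= d)%N.
Proof.
rewrite /inTN degNE; case/andP: (lambda_bounds r) => l0 _.
by rewrite -{2}(subnKC l0) mulnDl mul1n leq_add2r.
Qed.

Lemma phi_gt0 (r : rowT) (c : colT) : (0 < phi r c)%N.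
Proof. by rewrite phiE subn_gt0 colN_lt_height. Qed.

Lemma height_inj : injective height.
Proof.
move=> r r' E; have := lambda_bounds r; have := lambda_bounds r'.
have lt := rowN_colN_lt r; have lt' := rowN_colN_lt r'.
(* As N is square, having a row gives a column, and any column shows that the subtractions in
   [height] are not truncated. *)
have c0 : colT by rewrite -size_RN_CN.
move: (lt c0) (lt' c0) E; rewrite /height => {}lt {}lt' E /andP[l'0 l'p] /andP[l0 lp].
have [] := @eq_mod_residue p d p_prime p_ndvd_d (rowN r).1 (rowN r).2
  (rowN r').1 (rowN r').2 lp l'p.
  have Ed l : (0 < l)%N -> (l * d = (l - 1) * d + d)%N.
    by move=> l_gt0; rewrite mulnBl mul1n subnK // leq_pmull.
  by rewrite (Ed _ l0) (Ed _ l'0); lia.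
move=> E1 E2; have /eqP : rowN r = rowN r'.
  by rewrite [rowN r]surjective_pairing [rowN r']surjective_pairing E1 E2.
rewrite /rowN !(tnth_nth (0, 0)%N) nth_uniq ?RN_uniq //.
by move/eqP/val_inj.
Qed.

Lemma colN_inj : injective (@colN p d J).
Proof.
move=> c c' /eqP; rewrite /colN !(tnth_nth 0%N) nth_uniq ?CN_uniq //.
by move/eqP/val_inj.
Qed.

Lemma card_rowT_colT : #|rowT| = #|colT|.
Proof. by rewrite !card_ord size_RN_CN. Qed.

Lemma weight_attained_or_bounded (r : rowT) :
  (exists c : colT, height r - colN c = d)%N \/ (forall c : colT, height r - colN c <= d)%N.
Proof.
have := rowN_RN r; rewrite [rowN r]surjective_pairing => rR.
have /andP[l0 _] := lambda_bounds r.
have Ed : ((rowN r).2 * d = ((rowN r).2 - 1) * d + d)%N.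
  by rewrite mulnBl mul1n subnK // leq_pmull.
have [[y yC E]|H] := RN_weight p_prime p_ndvd_d J_bounds rR; [left|right].
  have /tnthP[c cy] : y \in in_tuple (CN p d J) by [].
  by exists c; rewrite /height /colN -cy E Ed; lia.
by move=> c; have := H _ (colN_CN c); rewrite /height Ed; lia.
Qed.

Lemma NmxE (r : rowT) (c : colT) :
  Nmx k p d J r c = bcoef k d (rowN r).2 (p * (rowN r).1 - colN c).
Proof. by rewrite mxE. Qed.

Lemma LM_entry (r : rowT) (c : colT) : inTN r c ->
  LM (Nmx k p d J r c)
    = (U_(inord (phi r c)) + U_(ord_max) *+ ((rowN r).2 - 1))%MM
  /\ Nmx k p d J r c != 0.
Proof.
rewrite inTNE => Tle; rewrite NmxE.
have -> := degNE r c : (p * (rowN r).1 - colN c = _)%N.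
have [/andP[l0 lp]] := (lambda_bounds r, phi_gt0 r c).
move: (rowN r).2 l0 lp => [//|l] _ lp ph0; rewrite subn1 /=.
have Ei : phi r c = (inord (phi r c) : 'I_d.+1) by rewrite inordK.
(* The leading coefficient may be lambda, here l + 1, which is nonzero in k since 0 < lambda < p. *)
have l0 : l.+1%:R != 0 :> k.
  by rewrite -(dvdn_pcharf charkp) gtnNdvd.
move: Ei; set i := inord _ => Ei; rewrite Ei in ph0 *.
rewrite LM_bcoef //; split=> //.
by apply: contraTneq (lead_in_msupp_bcoef i l0) => ->; rewrite msupp0.
Qed.

Lemma Nmx_eq0 (r : rowT) (c : colT) : (Nmx k p d J r c != 0) = inTN r c.
Proof.
case: (boolP (inTN r c)) => [/LM_entry[] //|]; rewrite /inTN -ltnNge NmxE => lt.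
by rewrite bcoef_eq0 ?eqxx.
Qed.

Lemma Pr_neq0 (s : {ffun rowT -> colT}) : (Pr k s != 0) <-> graph_in_TN s.
Proof.
split=> [/prodf_neq0 H r|H]; first by rewrite -Nmx_eq0 H.
by apply/prodf_neq0 => r _; rewrite Nmx_eq0.
Qed.

Lemma LM_Pr (s : {ffun rowT -> colT}) : graph_in_TN s ->
  LM (Pr k s) =
    [multinom (#|[set r | phi r (s r) == l :> nat]|
               + (if l == ord_max then Lambda p d J else 0))%N
       | l < d.+1].
Proof.
move=> sT; rewrite /Pr LM_prod; last by move=> r; rewrite Nmx_eq0.
apply/mnmP => l; rewrite mnmE mnm_sumE.
rewrite (eq_bigr (fun r => (phi r (s r) == l) + (ord_max == l) * ((rowN r).2 - 1))%N).
  rewrite big_split /= -big_distrr /= -/(Lambda p d J) eq_sym; congr (_ + _)%N.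
    by rewrite -sum1dep_card [RHS]big_mkcond; apply: eq_bigr => r _; case: eqP.
  by case: eqVneq; rewrite ?mul1n ?mul0n.
move=> r _; have [-> _] := LM_entry (sT r).
rewrite mnmDE mulmnE !mnm1E -val_eqE /= inordK //.
by rewrite ltnS -inTNE.
Qed.

(** The factor a_d^Lambda does not depend on [s], so comparing leading monomials amounts to
    comparing profiles. *)
Lemma LM_Pr_profile (s : {ffun rowT -> colT}) : graph_in_TN s ->
  LM (Pr k s) = (profile d height (@colN p d J) s
                 + U_(ord_max) *+ Lambda p d J)%MM.
Proof.
move=> sT; rewrite LM_Pr //; apply/mnmP => l.
rewrite mnmDE mulmnE mnm1E !mnmE eq_sym; congr (_ + _)%N.
  by apply: eq_card => r; rewrite !inE phiE.
by case: eqVneq; rewrite ?mul1n ?mul0n.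
Qed.

Lemma exists_dominant_Pr :
  exists s0 : {ffun rowT -> colT},
    [/\ bijective s0, graph_in_TN s0
      & forall s : {ffun rowT -> colT},
          bijective s -> s != s0 -> graph_in_TN s ->
          mlex_lt (LM (Pr k s)) (LM (Pr k s0))].
Proof.
have admP (s : {ffun rowT -> colT}) :
    admissible d height (@colN p d J) s <-> graph_in_TN s.
  by split => [/forallP H r|H]; [|apply/forallP => r]; have := H r;
    rewrite inTNE phiE.
have [s1 s1_inj s1_adm] := exists_admissible card_rowT_colT height_inj colN_inj
  colN_lt_height weight_attained_or_bounded.
have [s0 [s0_inj /admP s0T s0max]] := unique_max_profile card_rowT_colT
  height_inj colN_inj colN_lt_height s1_inj s1_adm.
exists s0; split=> // [|s /bij_inj s_inj ne sT].
  by apply: inj_card_bij => //; rewrite card_rowT_colT.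
by rewrite !LM_Pr_profile // mlex_ltD s0max //; exact/admP.
Qed.

(** In the Leibniz expansion the dominant monomial LM(Pr(s0)) occurs in the term of [s0] alone, so
    it cannot cancel. *)
Lemma det_Nmx_neq0 (sqN : size (CN p d J) = size (RN p d J)) :
  \det (castmx (erefl, sqN) (Nmx k p d J)) != 0.
Proof.
have [s0 [s0_bij s0T s0max]] := exists_dominant_Pr.
(* Permutations of the row indices are read as bijections from rows to columns through the equality
   of sizes. *)
pose F (s : 'S_(size (RN p d J))) : {ffun rowT -> colT} :=
  [ffun r => cast_ord (esym sqN) (s r)].
have F_bij s : bijective (F s).
  apply: inj_card_bij; last by rewrite card_rowT_colT.
  by move=> x y; rewrite !ffunE => /cast_ord_inj /perm_inj.
have -> : \det (castmx (erefl, sqN) (Nmx k p d J))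
    = \sum_(s : 'S_(size (RN p d J))) (-1) ^+ s * Pr k (F s).
  apply: eq_bigr => s _; congr (_ * _); apply: eq_bigr => r _.
  by rewrite castmxE ffunE cast_ord_id.
have g_inj : injective (fun r => cast_ord sqN (s0 r)).
  by move=> x y /cast_ord_inj /(bij_inj s0_bij).
have F0 : F (perm g_inj) = s0.
  by apply/ffunP => r; rewrite ffunE permE cast_ordK.
have Pr0 : Pr k s0 != 0 by apply/Pr_neq0.
have [L0 _] := LMP Pr0.
apply/eqP => /(congr1 (mcoeff (LM (Pr k s0)))); apply/eqP.
rewrite mcoeff0 raddf_sum (bigD1 (perm g_inj)) //= big1 ?addr0.
  by rewrite F0 mulr_sign; case: ifP => _; rewrite ?mcoeffN ?oppr_eq0 -mcoeff_msupp.
move=> s ne; suff E : (Pr k (F s))@_(LM (Pr k s0)) = 0.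
  by rewrite mulr_sign; case: ifP => _; rewrite ?mcoeffN E ?oppr0.
have [->|PrF] := eqVneq (Pr k (F s)) 0; first by rewrite mcoeff0.
apply: mcoeff_gt_LM; apply: s0max => //; last exact/Pr_neq0.
apply: contra_neq ne => EF; apply/permP => r.
by rewrite permE -EF ffunE cast_ordKV.
Qed.

End SquareSubmatrix.

Theorem theorem3p6 (k : fieldType) (p d J : nat)
    (p_prime : prime p) (p_odd : odd p) (charkp : p \in [pchar k])
    (d_gt0 : (0 < d)%N) (p_ndvd_d : ~~ (p %| d)%N) (J_bounds : (1 < J < p)%N) :
  [/\ (forall (r : 'I_(size (RN p d J))) (c : 'I_(size (CN p d J))),
        inTN r c ->
        LM (Nmx k p d J r c) = LM (bcoef k d (rowN r).2 (p * (rowN r).1 - colN c))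
        /\ LM (bcoef k d (rowN r).2 (p * (rowN r).1 - colN c))
           = (U_(inord (phi r c)) + U_(ord_max) *+ ((rowN r).2 - 1))%MM),
      (forall s : {ffun 'I_(size (RN p d J)) -> 'I_(size (CN p d J))},
        bijective s -> (Pr k s != 0 <-> graph_in_TN s)),
      (forall s : {ffun 'I_(size (RN p d J)) -> 'I_(size (CN p d J))},
        bijective s -> graph_in_TN s ->
        LM (Pr k s) =
          [multinom (#|[set r | phi r (s r) == l :> nat]|
                     + (if l == ord_max then Lambda p d J else 0))%N
             | l < d.+1]),
      (exists s0 : {ffun 'I_(size (RN p d J)) -> 'I_(size (CN p d J))},
        [/\ bijective s0, graph_in_TN s0
          & forall s : {ffun 'I_(size (RN p d J)) -> 'I_(size (CN p d J))},
              bijective s -> s != s0 -> graph_in_TN s ->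
              mlex_lt (LM (Pr k s)) (LM (Pr k s0))])
    & (exists sqN : size (CN p d J) = size (RN p d J),
        \det (castmx (erefl, sqN) (Nmx k p d J)) != 0)].
Proof.
split.
- move=> r c rcT; rewrite -NmxE; split=> //.
  by have [] := LM_entry p_prime charkp p_ndvd_d J_bounds rcT.
- by move=> s _; exact: Pr_neq0.
- by move=> s _ sT; exact: LM_Pr.
- exact: exists_dominant_Pr.
- have sqN := esym (size_RN_CN p_prime p_ndvd_d J_bounds).
  by exists sqN; exact: det_Nmx_neq0.
Qed.
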